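(* Let $\tau^{(1)}$ be defined by $\tau^{(1)}_{n,j}=\mathcal T^{(1)}_{n+3,j+3}$ for every $n\ge0$ and $1\le j\le n+1$. Then: (1) for every $n\ge2$, $\tau^{(1)}_{n,*}=[\tau^{(1)}_{n,1},\dots,\tau^{(1)}_{n,n+1}]$ is a strictly positive log-concave sequence; (2) $\tau^{(1)}$ generates a lower-triangular Toeplitz matrix when its diagonal is set to zero; that is, the infinite matrix $A=(A_{n,j})_{n\ge0,\,j\ge1}$ with $A_{n,j}=\tau^{(1)}_{n,j}$ for $1\le j\le n$ and $A_{n,j}=0$ for $j\ge n+1$ satisfies $A_{n+1,j+1}=A_{n,j}$ for all $n\ge0$, $j\ge1$.
   Context: Define $\psi:\{1,2,3,\dots\}\to\{0,1,2,\dots\}$ by $\psi(1)=0$, $\psi(2)=1$, $\psi(3)=2$ and $\psi(j)=\sum_{k=1}^{j-1}\psi(k)$ for $j\ge 4$. The triangular array $\mathcal T=(\mathcal T_{n,j})$, $n\ge 0$, $1\le j\le n+1$, of integers is defined recursively by: $\mathcal T_{n,n+1}=1$ for every $n\ge 0$; $\mathcal T_{1,1}=1$, $\mathcal T_{2,2}=2$, $\mathcal T_{3,3}=3$; $\mathcal T_{n,n}=\sum_{k=1}^{n-2}\mathcal T_{n-k,n-k}$ for every $n\ge 4$; and $\mathcal T_{n,j}=\mathcal T_{n-1,j}+\psi(j)$ for every $n\ge 2$ and $1\le j\le n-1$. The normalised array is $\mathcal T^{(1)}_{n,j}=2^{-n}\mathcal T_{n,j}$. A finite sequence $[\eta_1,\dots,\eta_{n+1}]$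 ($n\ge2$) of reals is log-concave if $\eta_{i-1}\eta_{i+1}\le\eta_i^2$ for all $2\le i\le n$. The diagonal of $\tau^{(1)}$ (rows indexed from $n=0$, columns from $j=1$) consists of the entries with $j=n+1$. *)

(* Defs.v *)
From mathcomp Require Import all_boot all_order all_algebra.

Set Implicit Arguments.
Unset Strict Implicit.
Unset Printing Implicit Defensive.

Import Order.TTheory GRing.Theory Num.Theory.

Local Open Scope ring_scope.

(* Course-of-values recursion for sequences indexed from 1:
   [course_of_values F n] is [:: u 1; ...; u n], where u m is computed by F
   from the list [:: u 1; ...; u (m - 1)]. *)
Fixpoint course_of_values (T : Type) (F : seq T -> T) (n : nat) : seq T :=
  if n is m.+1 then
    let s := course_of_values F m in rcons s (F s)
  else [::].

Definition psi_step (s : seq nat) : nat :=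
  match (size s).+1 with
  | 1%N => 0
  | 2%N => 1
  | 3%N => 2
  | j => \sum_(1 <= k < j) nth 0 s k.-1
  end%N.

(* The value at 0 is junk. *)
Definition psi (j : nat) : nat := nth 0%N (course_of_values psi_step j) j.-1.

(* The entries T_{n,n}; the value at 0 is junk. *)
Definition Tdiag_step (s : seq int) : int :=
  match (size s).+1 with
  | 1%N => 1
  | 2%N => 2
  | 3%N => 3
  | n => \sum_(1 <= k < n.-1) nth 0 s (n - k).-1
  end.

Definition Tdiag (n : nat) : int :=
  nth 0 (course_of_values Tdiag_step n) n.-1.

(* Indices j outside 1 <= j <= n + 1 are given the junk value 0. *)
Fixpoint Tarr (n j : nat) : int :=
  if j == n.+1 then 1
  else if n is m.+1 then
    if j == n then Tdiag n
    else if (1 <= j <= m)%N then Tarr m j + (psi j)%:Z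
    else 0
  else 0.

Lemma size_course_of_values (T : Type) (F : seq T -> T) n :
  size (course_of_values F n) = n.
Proof. by elim: n => //= n IHn; rewrite size_rcons IHn. Qed.

Lemma nth_course_of_values (T : Type) (F : seq T -> T) (x0 : T) n k :
  (0 < k <= n)%N ->
  nth x0 (course_of_values F n) k.-1 = nth x0 (course_of_values F k) k.-1.
Proof.
elim: n => [|n IHn] /andP[k_gt0]; first by rewrite leqNgt k_gt0.
rewrite leq_eqVlt => /predU1P[-> //|]; rewrite ltnS => le_kn.
rewrite [course_of_values F n.+1]/= nth_rcons size_course_of_values.
by rewrite prednK // le_kn IHn // k_gt0.
Qed.

Lemma course_of_valuesS (T : Type) (F : seq T -> T) (x0 : T) n :
  nth x0 (course_of_values F n.+1) n = F (course_of_values F n).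
Proof. by rewrite /= nth_rcons size_course_of_values ltnn eqxx. Qed.

Lemma psi1 : psi 1 = 0%N. Proof. by []. Qed.
Lemma psi2 : psi 2 = 1%N. Proof. by []. Qed.
Lemma psi3 : psi 3 = 2%N. Proof. by []. Qed.

Lemma psi_rec j : (4 <= j)%N -> psi j = (\sum_(1 <= k < j) psi k)%N.
Proof.
case: j => [|[|[|[|m]]]] // _; rewrite {1}/psi [m.+4.-1]/= course_of_valuesS.
rewrite /psi_step size_course_of_values; apply: eq_big_nat => k /andP[k0 kj].
by rewrite nth_course_of_values // k0.
Qed.

Lemma Tarr_last n : Tarr n n.+1 = 1.
Proof. by case: n => [|n] //=; rewrite eqxx. Qed.

Lemma Tarr_diag n : (1 <= n)%N -> Tarr n n = Tdiag n.
Proof. by case: n => //= n _; rewrite eqxx ltn_eqF. Qed.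

Lemma Tarr11 : Tarr 1 1 = 1. Proof. by []. Qed.
Lemma Tarr22 : Tarr 2 2 = 2. Proof. by []. Qed.
Lemma Tarr33 : Tarr 3 3 = 3. Proof. by []. Qed.

Lemma Tarr_diag_rec n : (4 <= n)%N ->
  Tarr n n = \sum_(1 <= k < n.-1) Tarr (n - k) (n - k).
Proof.
move=> n4; rewrite Tarr_diag; last by case: n n4.
case: n n4 => [|[|[|[|m]]]] // _.
rewrite {1}/Tdiag [m.+4.-1]/= course_of_valuesS.
rewrite /Tdiag_step size_course_of_values; apply: eq_big_nat => k /andP[k0 kn].
have lt_k : (k < m.+4)%N by apply: leq_trans kn _; apply: leqW.
rewrite Tarr_diag ?subn_gt0 // nth_course_of_values // subn_gt0 lt_k /=.
by rewrite leq_subLR -addn1 addnC leq_add2r.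
Qed.

Lemma Tarr_rec n j : (2 <= n)%N -> (1 <= j <= n.-1)%N ->
  Tarr n j = Tarr n.-1 j + (psi j)%:Z.
Proof.
case: n => //= n _ /andP[j0 jn]; rewrite j0 jn.
by rewrite !ltn_eqF // ltnS // (leq_trans jn).
Qed.

Definition T1 (R : realFieldType) (n j : nat) : R :=
  2 ^- n * (Tarr n j)%:~R.

(* Only meaningful for 1 <= j <= n + 1. *)
Definition tau1 (R : realFieldType) (n j : nat) : R := T1 R (n + 3) (j + 3).

(* A finite sequence [eta 1, ..., eta N] is given by its length N and a
   function eta, of which only the values at 1, ..., N matter. *)
Definition strictly_positive (R : realFieldType) (N : nat) (eta : nat -> R) :=
  forall i, (1 <= i <= N)%N -> 0 < eta i.

Definition log_concave (R : realFieldType) (N : nat) (eta : nat -> R) :=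
  forall i, (2 <= i <= N.-1)%N -> eta i.-1 * eta i.+1 <= eta i ^+ 2.

(* Infinite matrices have rows indexed from 0 and columns indexed from 1, so
   that the main diagonal consists of the entries (n, n + 1). *)
Definition zero_diagonal (R : realFieldType) (M : nat -> nat -> R)
    (n j : nat) : R :=
  if (1 <= j <= n)%N then M n j else 0.

Definition lower_triangular (R : realFieldType) (A : nat -> nat -> R) :=
  forall n j, (n.+1 < j)%N -> A n j = 0.

Definition toeplitz (R : realFieldType) (A : nat -> nat -> R) :=
  forall n j, (1 <= j)%N -> A n.+1 j.+1 = A n j.

(* Main.v *)
Require Import Defs.
From mathcomp Require Import all_boot all_order all_algebra.
From mathcomp Require Import ring lra zify.

Import Order.TTheory GRing.Theory Num.Theory.

Local Open Scope ring_scope.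

(** From index 4 on, each of [psi] and the subdiagonal [Tarr n n] is the sum of
    all (respectively, all but the first) of its previous terms, so it doubles
    at every step: [psi j = 3 * 2 ^ (j - 4)] and [Tarr n n = 5 * 2 ^ (n - 4)].
    Down a column the array is arithmetic with increment [psi j], hence
    [Tarr (j + m) j = 2 ^ (j - 4) * (5 + 3 * m)] for [4 <= j].  Dividing by the
    row factor [2 ^ (j + m)] cancels the dependence on [j]: below the diagonal,
    the entries of [tau1] depend only on the distance [m] to the subdiagonal, as
    [(5 + 3 * m) / 2 ^ (m + 4)].  This is the Toeplitz property.

    That profile is positive and log-concave, being the product of a geometric
    sequence, for which log-concavity is an equality, and of a positive
    arithmetic one.  In a row of [tau1] the only triple outside the profile is
    the last one, which ends in the diagonal entry [2 ^ - (n + 3)]; there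
    log-concavity reads [2 ^ - (n + 5) <= 25 / 256], which holds since the left
    side is at most [1 / 32]. *)

Lemma psi_closed m : psi m.+4 = (3 * 2 ^ m)%N.
Proof.
elim: m => [|m IHm]; first by rewrite psi_rec // unlock.
by rewrite psi_rec // big_nat_recr //= -psi_rec // IHm expnS; lia.
Qed.

Lemma Tarr_diag_closed m : Tarr m.+4 m.+4 = 5 * 2 ^+ m.
Proof.
elim: m => [|m IHm]; first by rewrite Tarr_diag_rec // big_nat_recl ?big_nat1.
(* The sum defining the entry runs backwards: its first term is the previous
   entry, and its tail is the sum defining that entry. *)
rewrite Tarr_diag_rec // big_ltn // big_add1 subn1 !succnK.
under eq_bigr => k _ do rewrite subSS.
by rewrite -(@Tarr_diag_rec m.+4) // IHm exprS; ring.
Qed.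

Lemma Tarr_column j m : (0 < j)%N ->
  Tarr (j + m) j = Tarr j j + (psi j)%:Z * m%:Z.
Proof.
move=> j_gt0; elim: m => [|m IHm]; first by rewrite addn0 mulr0 addr0.
by rewrite addnS Tarr_rec ?succnK ?IHm ?intS; [ring|lia..].
Qed.

Lemma Tarr_closed j m : Tarr (j.+4 + m) j.+4 = 2 ^+ j * (5 + 3 * m%:Z).
Proof.
rewrite Tarr_column // Tarr_diag_closed psi_closed PoszM.
by rewrite -[Posz (2 ^ j)]natz natrX; ring.
Qed.

Definition tau1_profile (R : realFieldType) (m : nat) : R :=
  2 ^- m * (5 + 3 * m%:R) / 16.

(** The column index survives only as the factor [2 ^ j] of both the integer
    entry and the row normalisation, so it cancels. *)
Lemma tau1_profileE (R : realFieldType) n j : (0 < j <= n)%N ->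
  tau1 R n j = tau1_profile R (n - j).
Proof.
case: j => // j /= lt_jn; rewrite -{1}(subnKC lt_jn).
move: (n - j.+1)%N => m {lt_jn}.
rewrite /tau1 /T1 addnAC !addn3 Tarr_closed /tau1_profile.
rewrite rmorphM rmorphXn rmorphD rmorphM /= !addSn !exprS exprD.
have j0 : 2 ^+ j != 0 :> R by rewrite expf_neq0 ?pnatr_eq0.
have m0 : 2 ^+ m != 0 :> R by rewrite expf_neq0 ?pnatr_eq0.
by field; rewrite j0 m0.
Qed.

Lemma tau1_diag (R : realFieldType) n : tau1 R n n.+1 = 2 ^- n / 8.
Proof.
rewrite /tau1 /T1 addSn Tarr_last mulr1 exprD invfM; congr (_ * _^-1); ring.
Qed.

Lemma tau1_profile_gt0 (R : realFieldType) m : 0 < tau1_profile R m.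
Proof.
have u0 : 0 < 2 ^- m :> R by rewrite invr_gt0 exprn_gt0.
have m0 : 0 <= m%:R :> R by [].
by rewrite /tau1_profile divr_gt0 // mulr_gt0 //; lra.
Qed.

Lemma tau1_profile_log_concave (R : realFieldType) m :
  tau1_profile R m.+2 * tau1_profile R m <= tau1_profile R m.+1 ^+ 2.
Proof.
(* The three geometric factors multiply to the same [(2 ^- m / 32) ^+ 2] on both
   sides; for the arithmetic factors [a - 3], [a], [a + 3] the gap is [3 ^ 2]. *)
rewrite -subr_ge0; suff -> : tau1_profile R m.+1 ^+ 2 -
    tau1_profile R m.+2 * tau1_profile R m = 9 * (2 ^- m / 32) ^+ 2.
  by rewrite mulr_ge0 ?sqr_ge0.
rewrite /tau1_profile !exprS !invfM -[m.+2%:R]natr1 -[m.+1%:R]natr1.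
by field; rewrite ?expf_neq0 ?pnatr_eq0.
Qed.

Lemma tau1_strictly_positive (R : realFieldType) n :
  strictly_positive n.+1 (tau1 R n).
Proof.
move=> [//|j] /= jn; have [->|lt_jn] := eqVneq j n.
  by rewrite tau1_diag divr_gt0 // invr_gt0 exprn_gt0.
by rewrite tau1_profileE ?tau1_profile_gt0 //; lia.
Qed.

Lemma tau1_log_concave (R : realFieldType) n : log_concave n.+1 (tau1 R n).
Proof.
move=> [//|i] /= i_bounds; have [->|ne_in] := eqVneq n i.+1.
  (* The outer neighbour is the diagonal entry, which is outside the profile. *)
  have i_gt0 : (0 < i)%N by lia.
  rewrite tau1_diag !tau1_profileE ?i_gt0 //= subnn subSnn /tau1_profile.
  rewrite expr0 expr1 exprS invfM; have : 2 ^- i <= 1 :> R.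
    by rewrite invf_le1 ?exprn_gt0 ?exprn_ege1 ?ler1n.
  lra.
rewrite !tau1_profileE; try lia.
rewrite (_ : n - i = (n - i.+2).+2)%N; last by lia.
rewrite (_ : n - i.+1 = (n - i.+2).+1)%N; last by lia.
exact: tau1_profile_log_concave.
Qed.

Lemma zero_diagonal_lower_triangular (R : realFieldType) (M : nat -> nat -> R) :
  lower_triangular (zero_diagonal M).
Proof. by move=> n j nj; rewrite /zero_diagonal ifF //; lia. Qed.

Lemma tau1_toeplitz (R : realFieldType) : toeplitz (zero_diagonal (tau1 R)).
Proof.
move=> n [//|j] _; rewrite /zero_diagonal /= ltnS; case: ifP => // jn.
by rewrite !tau1_profileE ?subSS.
Qed.

Theorem proposition2p19 (R : realFieldType) :
  (forall n : nat, (2 <= n)%N ->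
     strictly_positive n.+1 (tau1 R n) /\ log_concave n.+1 (tau1 R n)) /\
  (lower_triangular (zero_diagonal (tau1 R)) /\
   toeplitz (zero_diagonal (tau1 R))).
Proof.
split=> [n _|]; first by split; [exact: tau1_strictly_positive|
                                 exact: tau1_log_concave].
by split; [exact: zero_diagonal_lower_triangular | exact: tau1_toeplitz].
Qed.
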